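(* For a function $\sigma:\mathbb Z\to\mathbb C$, $$\sigma(\xi+\eta)=\sum_{\alpha=0}^{N-1}\frac1{\alpha!}\,(\triangle_\xi^\alpha\sigma)(\xi)\,\eta^{(\alpha)}+R_N(\xi,\eta)\qquad(\xi,\eta\in\mathbb Z,\ N\in\mathbb N),$$ where, for every $\alpha\in\mathbb N$, $$|\triangle_\xi^\alpha R_N(\xi,\eta)|\le\begin{cases}\frac1{N!}\,\eta^{(N)}\,\max_{0\le\kappa<\eta}\left|\triangle_\xi^{N+\alpha}\sigma(\xi+\kappa)\right|,&\eta\ge N,\\ 0,&0\le\eta<N,\\ \frac1{N!}\,|\eta^{(N)}|\,\max_{\eta\le\kappa<0}\left|\triangle_\xi^{N+\alpha}\sigma(\xi+\kappa)\right|,&\eta<0,\end{cases}$$ and the right-hand side is in turn at most $$\frac1{N!}\,|\eta^{(N)}|\,\max_{\kappa\in\{0,\ldots,\eta\}}\left|\triangle_\xi^{N+\alpha}\sigma(\xi+\kappa)\right|.$$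
   Context: Here $\mathbb N=\{0,1,2,\ldots\}$. For a function $f:\mathbb Z\to\mathbb C$, $(\triangle_\xi f)(\xi):=f(\xi+1)-f(\xi)$, and $\triangle_\xi^\alpha$ is its $\alpha$-fold iterate ($\triangle_\xi^0$ is the identity); $\triangle_\xi^\alpha R_N(\xi,\eta)$ means the difference is taken in the variable $\xi$ with $\eta$ fixed, and $\triangle_\xi^{\beta}\sigma(\xi+\kappa)$ means $(\triangle_\xi^\beta\sigma)$ evaluated at $\xi+\kappa$. For $\eta\in\mathbb Z$ and an integer $k>0$, $\eta^{(k)}:=\prod_{i=0}^{k-1}(\eta-i)$, and $\eta^{(0)}:=1$. The remainder $R_N(\xi,\eta)$ is defined by the displayed expansion. The set $\{0,\ldots,\eta\}$ is the set of all integers between $0$ and $\eta$ inclusive (also when $\eta<0$). All variables $\kappa$ are integers.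
   Formalization: For N = 0 and η ≥ 0 the case-by-case bound is false (σ the indicator of {1}, ξ = 0, η = 1, α = 0) or has an empty maximum (η = 0), so it is claimed only for N > 0 or η < 0; the final uniform bound on the differences of R_N is proved in all cases. *)

(* Defs.v *)
From mathcomp Require Export all_boot all_order all_algebra.
From mathcomp Require Export reals complex.

Set Implicit Arguments.
Unset Strict Implicit.
Unset Printing Implicit Defensive.

Import Order.TTheory GRing.Theory Num.Theory.
Local Open Scope ring_scope.

Definition fdiff (V : zmodType) (f : int -> V) : int -> V :=
  fun xi => f (xi + 1) - f xi.

Definition fdiffn (V : zmodType) (n : nat) (f : int -> V) : int -> V :=
  iter n (@fdiff V) f.

(* eta^(k) = eta (eta - 1) ... (eta - k + 1), an integer of either sign. *)
Definition ffactz (eta : int) (k : nat) : int :=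
  \prod_(i < k) (eta - (i : nat)%:Z).

(* The integers k with a <= k < b, see mem_zrange. *)
Definition zrange (a b : int) : seq int :=
  if a <= b then [seq a + i%:Z | i <- iota 0 `|b - a|%N] else [::].

Lemma mem_zrange (a b k : int) : (k \in zrange a b) = (a <= k < b).
Proof.
rewrite /zrange; case: ifPn => [ab|]; last first.
  rewrite -ltNge => ba; rewrite in_nil; apply/esym/negbTE/negP => /andP[ak kb].
  by move: (lt_trans (le_lt_trans ak kb) ba); rewrite ltxx.
apply/mapP/andP => [[j]|[ak kb]].
  rewrite mem_iota /= add0n => jlt ->; split; first by rewrite lerDl.
  by rewrite addrC -ltrBrDr -(gez0_abs (_ : 0 <= b - a)) ?subr_ge0 ?ltz_nat.
exists `|k - a|%N.
  by rewrite mem_iota /= add0n -ltz_nat !gez0_abs ?subr_ge0 // ltrD2r.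
by rewrite gez0_abs ?subr_ge0 ?subrKC.
Qed.

(* {0, ..., eta}: the integers between 0 and eta inclusive, for either sign
   of eta. *)
Definition zsegment (eta : int) : seq int :=
  zrange (Num.min 0 eta) (Num.max 0 eta + 1).

Section Remainder.
Variable R : realType.
Implicit Types (sigma : int -> R[i]) (N alpha : nat) (xi eta : int).

Definition cmod (z : R[i]) : R := Normc.normc z.

(* The maximum of |f| over s.  The seed 0 is harmless, as moduli are
   nonnegative; the maximum over the empty sequence is 0. *)
Definition max_mod (s : seq int) (f : int -> R[i]) : R :=
  \big[Num.max/0]_(k <- s) cmod (f k).

Definition taylor_rem sigma N xi eta : R[i] :=
  sigma (xi + eta) -
  \sum_(alpha < N)
    (alpha`!%:R)^-1 * fdiffn alpha sigma xi * (ffactz eta alpha)%:~R.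

Definition rem_bound sigma N alpha xi eta : R :=
  let f := fun k => fdiffn (N + alpha) sigma (xi + k) in
  if N%:Z <= eta then
    (N`!%:R)^-1 * (ffactz eta N)%:~R * max_mod (zrange 0 eta) f
  else if 0 <= eta then 0
  else (N`!%:R)^-1 * `|ffactz eta N|%:~R * max_mod (zrange eta 0) f.

Definition rem_bound_unif sigma N alpha xi eta : R :=
  let f := fun k => fdiffn (N + alpha) sigma (xi + k) in
  (N`!%:R)^-1 * `|ffactz eta N|%:~R * max_mod (zsegment eta) f.

End Remainder.

(* Main.v *)
Require Import Defs.
From mathcomp Require Import ring zify.
Set Implicit Arguments.
Unset Strict Implicit.
Unset Printing Implicit Defensive.
Import Order.TTheory GRing.Theory Num.Theory.
Local Open Scope ring_scope.

(* In eta the remainder R_N satisfies R_(N+1)[sigma](xi, eta + 1)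
   - R_(N+1)[sigma](xi, eta) = R_N[fdiff sigma](xi, eta) and
   R_(N+1)[sigma](xi, 0) = 0, while R_0[sigma](xi, eta) = sigma (xi + eta).
   Summing this recurrence upwards from 0 when eta >= 0 and downwards when
   eta < 0, with the triangle inequality at each step, gives the bound by
   induction on N: the constants obey Pascal's rule, hence equal 'C(eta, N) and
   'C(N - eta - 1, N) respectively, which are |eta^(N)| / N!.  Differences in
   xi commute with R_N, so the case alpha = 0 suffices. *)

Section FiniteDifferences.
Variables (V : zmodType).
Implicit Types f g : int -> V.

Lemma eq_fdiffn n f g : f =1 g -> fdiffn n f =1 fdiffn n g.
Proof.
by move=> fg; elim: n => [|n IHn] x /=; rewrite ?fg // /fdiff !IHn.
Qed.

Lemma fdiffnSr n f : fdiffn n.+1 f = fdiffn n (fdiff f).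
Proof. exact: iterSr. Qed.

Lemma fdiffnD m n f : fdiffn (m + n) f = fdiffn m (fdiffn n f).
Proof. exact: iterD. Qed.

End FiniteDifferences.

Section FallingFactorial.
Implicit Types (eta : int) (k n p : nat).

Lemma ffactz0 eta : ffactz eta 0 = 1.
Proof. exact: big_ord0. Qed.

Lemma ffactzSr eta k : ffactz eta k.+1 = ffactz eta k * (eta - k%:Z).
Proof. exact: big_ord_recr. Qed.

Lemma ffactzSl eta k : ffactz (eta + 1) k.+1 = (eta + 1) * ffactz eta k.
Proof.
rewrite /ffactz big_ord_recl subr0; congr (_ * _).
by apply: eq_bigr => i _ /=; rewrite /bump PoszD opprD addrA addrK.
Qed.

(** The discrete power rule; it holds because [eta + 1 = (eta - k) + (k + 1)]. *)
Lemma ffactzD1 eta k :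
  ffactz (eta + 1) k.+1 = ffactz eta k.+1 + k.+1%:Z * ffactz eta k.
Proof. by rewrite ffactzSl ffactzSr -addn1 PoszD; ring. Qed.

Lemma ffactz0S k : ffactz 0 k.+1 = 0.
Proof. by rewrite /ffactz big_ord_recl subr0 mul0r. Qed.

Lemma ffactz_nat n k : ffactz n%:Z k = (n ^_ k)%:Z.
Proof.
elim: k => [|k IHk]; first by rewrite ffactz0 ffactn0.
rewrite ffactzSr IHk ffactnSr PoszM.
have [kn|nk] := leqP k n; first by rewrite subzn.
by rewrite ffact_small // !mul0r.
Qed.

(** The factors are [-(p + 1), ..., -(p + k)], all negative, so their moduli form a falling
    factorial starting at [p + k]. *)
Lemma normr_ffactz_neg p k : `|ffactz (- p.+1%:Z) k| = ((p + k) ^_ k)%:Z.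
Proof.
elim: k => [|k IHk]; first by rewrite ffactz0 ffactn0.
rewrite ffactzSr normrM IHk addnS ffactnS /= mulrC PoszM; congr (_ * _).
by lia.
Qed.

End FallingFactorial.

Section TaylorRemainder.
Variable R : realType.
Implicit Types (sigma : int -> R[i]) (N alpha : nat) (xi eta : int).
Implicit Types (s t : seq int) (f : int -> R[i]) (M : R).

Lemma max_mod_ge s f k : k \in s -> cmod (f k) <= max_mod s f.
Proof.
by move=> ks; exact: (le_bigmax_seq _ k predT (fun j => cmod (f j))).
Qed.

Lemma max_mod_shift_ge s f xi k :
  k \in s -> cmod (f (xi + k)) <= max_mod s (fun j => f (xi + j)).
Proof. exact: (max_mod_ge (fun j => f (xi + j))). Qed.

Lemma max_mod_ge0 s f : 0 <= max_mod s f.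
Proof. exact: bigmax_ge_id. Qed.

Lemma max_mod_sub s t f : {subset s <= t} -> max_mod s f <= max_mod t f.
Proof. exact: sub_bigmax_seq. Qed.

Lemma cmodD (z w : R[i]) : cmod (z + w) <= cmod z + cmod w.
Proof. exact: le_normcD. Qed.

Lemma cmodB (z w : R[i]) : cmod (z - w) <= cmod z + cmod w.
Proof. by rewrite -[cmod w]normcN; exact: le_normcD. Qed.

Lemma cmod0 : cmod (0 : R[i]) = 0.
Proof. exact: Normc.normc0. Qed.

Lemma taylor_rem0 sigma xi eta : taylor_rem sigma 0 xi eta = sigma (xi + eta).
Proof. by rewrite /taylor_rem big_ord0 subr0. Qed.

Lemma taylor_remS0 sigma N xi : taylor_rem sigma N.+1 xi 0 = 0.
Proof.
rewrite /taylor_rem big_ord_recl ffactz0 fact0 invr1 mul1r mulr1 addr0.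
by rewrite big1 ?addr0 ?subrr // => i _; rewrite ffactz0S mulr0.
Qed.

(** The terms of index 0 cancel, and the power rule turns the increment of the term of index [i + 1]
    into the term of index [i] for [fdiff sigma]. *)
Lemma taylor_remD1 sigma N xi eta :
  taylor_rem sigma N.+1 xi (eta + 1) =
  taylor_rem sigma N.+1 xi eta + taylor_rem (fdiff sigma) N xi eta.
Proof.
rewrite /taylor_rem !big_ord_recl !ffactz0 /fdiff addrA -/(fdiff sigma).
set S1 := \sum_(i < N) _; set S2 := \sum_(i < N) _; set S3 := \sum_(i < N) _.
suff -> : S1 = S2 + S3 by ring.
rewrite /S1 /S2 /S3 -big_split; apply: eq_bigr => i _.
rewrite !lift0 ffactzD1 fdiffnSr intrD intrM mulrDr; congr (_ + _).
have i0 : (i.+1%:R : R[i]) != 0 by rewrite pnatr_eq0.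
(* The factor [i + 1] of the power rule cancels in [(i + 1)!], leaving [1 / i!]. *)
rewrite factS natrM invfM -[(i.+1%:Z)%:~R]/(i.+1%:R) -!mulrA.
by rewrite mulrCA [X in _ * (_ * X)]mulrCA mulKf // mulrCA.
Qed.

(** The remainder is linear in [sigma], and its coefficients depend on [eta] alone. *)
Lemma fdiffn_taylor_rem sigma N alpha xi eta :
  fdiffn alpha (fun x => taylor_rem sigma N x eta) xi =
  taylor_rem (fdiffn alpha sigma) N xi eta.
Proof.
elim: alpha sigma xi => [|alpha IHa] sigma xi //.
rewrite !fdiffnSr -IHa; apply: eq_fdiffn => x.
rewrite /fdiff /taylor_rem -/(fdiff sigma) [x + 1 + eta]addrAC.
set S1 := \sum_(_ < _) _; set S2 := \sum_(_ < _) _; set S3 := \sum_(_ < _) _.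
suff -> : S3 = S1 - S2 by rewrite /fdiff; ring.
rewrite /S1 /S2 /S3 -sumrB; apply: eq_bigr => i _.
by rewrite -fdiffnSr -mulrBl -mulrBr.
Qed.

(** The range of [k] includes [n] itself exactly when [N = 0], where the remainder is
    [sigma (xi + n)]. *)
Lemma taylor_rem_nat_le sigma N xi (n : nat) M :
    (forall k : nat, (k < n + (N == 0%N))%N ->
      cmod (fdiffn N sigma (xi + k%:Z)) <= M) ->
  cmod (taylor_rem sigma N xi n%:Z) <= 'C(n, N)%:R * M.
Proof.
elim: N sigma n => [|N IHN] sigma n.
  by move=> leM; rewrite taylor_rem0 bin0 mul1r leM ?addn1.
rewrite addn0; elim: n => [|n IHn] leM.
  by rewrite taylor_remS0 cmod0 bin0n mul0r.
rewrite intS [1 + _]addrC taylor_remD1 binS natrD mulrDl.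
apply: le_trans (cmodD _ _) _; apply: lerD.
  by apply: IHn => k kn; apply: leM; exact: ltnW.
(* The extra point [k = n] needed when [N = 0] still lies in the range [k < n + 1] available
   here. *)
apply: IHN => k kn; rewrite -fdiffnSr; apply: leM.
by case: (N == 0%N) kn => /=; lia.
Qed.

Lemma taylor_rem_neg_le sigma N xi (p : nat) M :
    (forall k : nat, (k <= p)%N -> cmod (fdiffn N sigma (xi - k.+1%:Z)) <= M) ->
  cmod (taylor_rem sigma N xi (- p.+1%:Z)) <= 'C(p + N, N)%:R * M.
Proof.
elim: N sigma p => [|N IHN] sigma p.
  by move=> leM; rewrite taylor_rem0 bin0 mul1r leM.
(* The recurrence read downwards; the lower-order remainder is taken at the new endpoint [-(q + 1)],
   which the range of [M] contains. *)
have step q : taylor_rem sigma N.+1 xi (- q.+1%:Z) =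
    taylor_rem sigma N.+1 xi (- q%:Z)
    - taylor_rem (fdiff sigma) N xi (- q.+1%:Z).
  have -> : - q%:Z = - q.+1%:Z + 1 by lia.
  by rewrite taylor_remD1 addrK.
elim: p => [|p IHp] leM.
  (* At [eta = -1] a single term survives, and both binomial constants equal 1. *)
  rewrite step oppr0 taylor_remS0 binn; apply: le_trans (cmodB _ _) _.
  rewrite cmod0 add0r; move: (IHN (fdiff sigma) 0%N); rewrite binn; apply.
  by move=> k kp; rewrite -fdiffnSr leM.
rewrite step addSn addnS binS natrD mulrDl.
apply: le_trans (cmodB _ _) _; apply: lerD.
  by rewrite -addnS; apply: IHp => k kp; apply: leM; exact: leqW.
by rewrite -addSn; apply: IHN => k kp; rewrite -fdiffnSr; exact: leM.
Qed.

Lemma natr_bin n k : ('C(n, k)%:R : R) = k`!%:R^-1 * (n ^_ k)%:R.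
Proof.
by rewrite -bin_ffact natrM mulrCA mulVf ?mulr1 // pnatr_eq0 -lt0n fact_gt0.
Qed.

Lemma rem_bound_le_unif sigma N alpha xi eta :
  rem_bound sigma N alpha xi eta <= rem_bound_unif sigma N alpha xi eta.
Proof.
have coef_ge0 : 0 <= (N`!%:R)^-1 * `|ffactz eta N|%:~R :> R.
  by rewrite mulr_ge0 ?invr_ge0 ?ler0n ?ler0z.
rewrite /rem_bound /rem_bound_unif.
case: ifPn => [Neta|_]; last case: ifPn => [_|].
(* Here [eta] is a natural number, so its falling factorial is nonnegative. *)
- have -> : ffactz eta N = `|ffactz eta N|.
    by case: eta Neta {coef_ge0} => // n _; rewrite ffactz_nat.
  rewrite normr_id; apply: ler_wpM2l => //; apply: max_mod_sub => k.
  by rewrite /zsegment !mem_zrange; lia.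
- by rewrite mulr_ge0 ?max_mod_ge0.
- rewrite -ltNge => eta0; apply: ler_wpM2l => //; apply: max_mod_sub => k.
  by rewrite /zsegment !mem_zrange; lia.
Qed.

Lemma taylor_rem_le_rem_bound sigma N alpha xi eta :
    (0 < N)%N || (eta < 0) ->
  cmod (taylor_rem (fdiffn alpha sigma) N xi eta) <=
    rem_bound sigma N alpha xi eta.
Proof.
rewrite /rem_bound; cbv zeta; case: eta => [n|p].
  rewrite orbF => N0.
  set M := max_mod _ _; have leM : cmod (taylor_rem (fdiffn alpha sigma) N xi n)
      <= 'C(n, N)%:R * M.
    apply: taylor_rem_nat_le => k kn; rewrite -fdiffnD.
    by apply: max_mod_shift_ge; rewrite mem_zrange; lia.
  case: ifPn => [_|nN]; first by rewrite ffactz_nat -natr_bin.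
  (* For [0 <= eta < N] the binomial constant vanishes, which gives the bound 0. *)
  by rewrite bin_small ?mul0r // in leM; lia.
move=> _; rewrite NegzE.
have /negbTE -> : ~~ (N%:Z <= - p.+1%:Z) by lia.
have /negbTE -> : ~~ (0 <= - p.+1%:Z) by lia.
rewrite normr_ffactz_neg -[_%:~R]/(_%:R) -natr_bin.
apply: taylor_rem_neg_le => k kp; rewrite -fdiffnD.
by apply: max_mod_shift_ge; rewrite mem_zrange; lia.
Qed.

Lemma taylor_rem_le_rem_bound_unif sigma N alpha xi eta :
  cmod (taylor_rem (fdiffn alpha sigma) N xi eta) <=
    rem_bound_unif sigma N alpha xi eta.
Proof.
have [Neta|] := boolP ((0 < N)%N || (eta < 0)).
  apply: le_trans (rem_bound_le_unif _ _ _ _ _).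
  exact: taylor_rem_le_rem_bound.
(* What is left is [N = 0], [eta >= 0]: the remainder is [sigma (xi + eta)], and [eta] belongs to
   [zsegment eta]. *)
rewrite negb_or -leqNgt leqn0 -leNgt => /andP[/eqP -> eta0].
rewrite taylor_rem0 /rem_bound_unif ffactz0 fact0 invr1 !mul1r.
by apply: max_mod_shift_ge; rewrite /zsegment mem_zrange; lia.
Qed.

End TaylorRemainder.

(* For N = 0 and eta >= 0 the case-by-case bound is false (xi = 0, eta = 1,
   alpha = 0, sigma the indicator function of 1), so there it is replaced by
   the uniform bound alone. *)
Theorem theorem2p3 (R : realType) (sigma : int -> R[i]) (N : nat) :
  (forall xi eta : int,
     sigma (xi + eta) =
       \sum_(alpha < N)
         (alpha`!%:R)^-1 * fdiffn alpha sigma xi * (ffactz eta alpha)%:~R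
       + taylor_rem sigma N xi eta) /\
  (forall (alpha : nat) (xi eta : int),
     [/\ (0 < N)%N || (eta < 0) ->
           cmod (fdiffn alpha (fun x => taylor_rem sigma N x eta) xi)
             <= rem_bound sigma N alpha xi eta,
         rem_bound sigma N alpha xi eta <= rem_bound_unif sigma N alpha xi eta
       & cmod (fdiffn alpha (fun x => taylor_rem sigma N x eta) xi)
           <= rem_bound_unif sigma N alpha xi eta]).
Proof.
split=> [xi eta|alpha xi eta]; first by rewrite /taylor_rem [RHS]addrC subrK.
rewrite fdiffn_taylor_rem; split.
- exact: taylor_rem_le_rem_bound.
- exact: rem_bound_le_unif.
- exact: taylor_rem_le_rem_bound_unif.
Qed.
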